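(* Let $\Omega=[a,b]$ and let $(w,p_w,\phi,p_\phi)$ be a sufficiently smooth solution of the implicit Timoshenko system $$\begin{bmatrix}\partial_tw\\\partial_tp_w\\\partial_t\phi\\\partial_tp_\phi\end{bmatrix}=\begin{bmatrix}0&\mathrm{Id}&0&0\\-\mathrm{Id}&0&0&0\\0&0&0&\mathrm{Id}\\0&0&-\mathrm{Id}&0\end{bmatrix}\begin{bmatrix}\delta_w\mathcal{H}^I\\\delta_{p_w}\mathcal{H}^I\\\delta_\phi\mathcal{H}^I\\\delta_{p_\phi}\mathcal{H}^I\end{bmatrix}$$ with Hamiltonian $$\mathcal{H}^I=\frac12\int_\Omega\Big(\frac{1}{\rho A}p_w^2+\frac1{\rho I}p_\phi^2+T_0(\partial_xw)^2+EI(\partial_x\phi)^2+A\kappa G(\partial_xw-\phi)^2\Big)dx.$$ Then the power balance reads $$\frac{d}{dt}\mathcal{H}^I=\big[\partial_tw\,\big(T_0\,\partial_xw+A\kappa G(\partial_xw-\phi)\big)+\partial_t\phi\,EI\,\partial_x\phi\big]_a^b.$$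
   Context: $\rho,A,T_0,\kappa,G,I,E$ are positive time-independent physical parameters (mass density, cross-section area, tension, shear coefficient, shear modulus, moment of inertia, Young's modulus). The (weak) variational derivatives, i.e. those obtained by testing against smooth functions compactly supported in the interior of $\Omega$, are $$\delta_w\mathcal{H}^I=-\partial_x(T_0\partial_xw)-\partial_x\big(A\kappa G(\partial_xw-\phi)\big),\quad \delta_{p_w}\mathcal{H}^I=\frac{p_w}{\rho A},$$ $$\delta_\phi\mathcal{H}^I=-\partial_x(EI\,\partial_x\phi)-A\kappa G(\partial_xw-\phi),\quad \delta_{p_\phi}\mathcal{H}^I=\frac{p_\phi}{\rho I}.$$ $[g]_a^b:=g(b)-g(a)$. No boundary conditions are imposed. *)

(* Defs.v *)
From Stdlib Require Import Reals.
From Coquelicot Require Import Coquelicot.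
Open Scope R_scope.

(* A time-dependent field is [f : R -> R -> R], time first, so that [f t] is its
   spatial profile at time t. *)
Definition d_t (f : R -> R -> R) (t x : R) : R := Derive (fun s => f s x) t.
Definition d_x (f : R -> R -> R) (t x : R) : R := Derive (f t) x.

(* Functions on [a, b] are represented by total functions on R, only their values
   on [a, b] being relevant. Being of class C^k up to the boundary means, as
   usual, being C^k on some open neighbourhood, so that the two-sided [Derive] is
   the right derivative at the endpoints too. *)
Definition C1_on_interval (a b : R) (f : R -> R) : Prop :=
  forall x : R, a <= x <= b ->
    locally x (fun y => ex_derive f y /\ continuous (Derive f) y).

Fixpoint C_class (k : nat) (U : R -> R -> Prop) (f : R -> R -> R) : Prop :=
  match k with
  | O => forall t x : R, U t x -> continuity_2d_pt f t x
  | S k' =>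
      (forall t x : R, U t x -> ex_derive (fun s => f s x) t /\ ex_derive (f t) x)
      /\ C_class k' U (d_t f) /\ C_class k' U (d_x f)
  end.

Definition C_class_near (k : nat) (D : R -> R -> Prop) (f : R -> R -> R) : Prop :=
  exists U : R -> R -> Prop,
    (forall t x : R, U t x -> locally_2d U t x)
    /\ (forall t x : R, D t x -> U t x)
    /\ C_class k U f.

(* The time interval is open and possibly unbounded. *)
Definition in_time (t0 t1 : Rbar) (t : R) : Prop := Rbar_lt t0 t /\ Rbar_lt t t1.

Definition space_time (t0 t1 : Rbar) (a b : R) (t x : R) : Prop :=
  in_time t0 t1 t /\ a <= x <= b.

(* The parameters do not depend on time, but they may vary along the beam. *)
Record params : Type := Params {
  rho : R -> R;      (* mass density *)
  area : R -> R;     (* cross-section area, A *)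
  T0 : R -> R;       (* tension *)
  kappa : R -> R;    (* shear coefficient *)
  shear : R -> R;    (* shear modulus, G *)
  inertia : R -> R;  (* moment of inertia, I *)
  young : R -> R     (* Young's modulus, E *)
}.

Definition regular_on (a b : R) (f : R -> R) : Prop :=
  (forall x : R, a <= x <= b -> 0 < f x) /\ C1_on_interval a b f.

Definition admissible (a b : R) (P : params) : Prop :=
  regular_on a b (rho P) /\ regular_on a b (area P) /\ regular_on a b (T0 P)
  /\ regular_on a b (kappa P) /\ regular_on a b (shear P)
  /\ regular_on a b (inertia P) /\ regular_on a b (young P).

Definition AkG (P : params) (x : R) : R := area P x * kappa P x * shear P x.
Definition EI (P : params) (x : R) : R := young P x * inertia P x.

Definition hamiltonian (a b : R) (P : params) (w pw phi pphi : R -> R) : R :=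
  / 2 * RInt (fun x =>
      / (rho P x * area P x) * pw x ^ 2
      + / (rho P x * inertia P x) * pphi x ^ 2
      + T0 P x * Derive w x ^ 2
      + EI P x * Derive phi x ^ 2
      + AkG P x * (Derive w x - phi x) ^ 2) a b.

Definition test_function (a b : R) (eta : R -> R) : Prop :=
  (forall (n : nat) (x : R), ex_derive_n eta n x)
  /\ exists c d : R, a < c /\ d < b /\ forall x : R, eta x <> 0 -> c <= x <= d.

(* [g] is the weak variational derivative of [F] at [u]. Continuity pins [g] down
   on [a, b] as a function rather than almost everywhere. For the partial
   functionals of [hamiltonian] at a smooth state, integration by parts turns
   this into
     delta_w    = - (T0 w')' - (AkG (w' - phi))',   delta_pw   = pw / (rho A),
     delta_phi  = - (EI phi')' - AkG (w' - phi),    delta_pphi = pphi / (rho I). *)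
Definition is_weak_variational_derivative (a b : R)
    (F : (R -> R) -> R) (u g : R -> R) : Prop :=
  continuous_on (fun x => a <= x <= b) g
  /\ forall eta : R -> R, test_function a b eta ->
       is_derive (fun eps : R => F (fun x => u x + eps * eta x)) 0
                 (RInt (fun x => g x * eta x) a b).

Definition timoshenko_system (a b : R) (P : params) (w pw phi pphi : R -> R -> R)
    (t : R) : Prop :=
  let H := hamiltonian a b P in
  exists delta_w delta_pw delta_phi delta_pphi : R -> R,
    is_weak_variational_derivative a b
      (fun u => H u (pw t) (phi t) (pphi t)) (w t) delta_w
    /\ is_weak_variational_derivative a b
         (fun u => H (w t) u (phi t) (pphi t)) (pw t) delta_pw
    /\ is_weak_variational_derivative a b
         (fun u => H (w t) (pw t) u (pphi t)) (phi t) delta_phi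
    /\ is_weak_variational_derivative a b
         (fun u => H (w t) (pw t) (phi t) u) (pphi t) delta_pphi
    /\ forall x : R, a <= x <= b ->
         d_t w t x = delta_pw x
         /\ d_t pw t x = - delta_w x
         /\ d_t phi t x = delta_pphi x
         /\ d_t pphi t x = - delta_phi x.

Definition boundary_bracket (g : R -> R) (a b : R) : R := g b - g a.

(* Main.v *)
Require Import Defs.
From Stdlib Require Import Reals Factorial Lra.
From Coquelicot Require Import Coquelicot.
Open Scope R_scope.

(* Integrating by parts against test functions, which vanish near the ends of the
   beam, turns the four weak variational derivatives into integrals against explicit
   continuous functions; the fundamental lemma of the calculus of variations then
   makes the implicit system hold pointwise, up to the boundary. Differentiating
   the Hamiltonian under the integral sign and exchanging the derivatives in t and
   x, the rate of the energy density is twice the x-derivative of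
     d_t w (T0 d_x w + AkG (d_x w - phi)) + d_t phi EI d_x phi,
   whose integral is the boundary bracket. *)

(** * Bump functions and the fundamental lemma of the calculus of variations *)

(** The rate of the Hamiltonian along a solution is its variation in the direction of the
    velocities, but these need not vanish at [a] and [b], so they are not admissible test
    directions: the weak formulation cannot be applied to them, and the bracket is exactly what it
    fails to see. This is why the proof goes through the pointwise equations. The variational
    derivatives in the system are mere existential witnesses, known through integrals against test
    functions; their continuity on the closed interval is what makes them comparable with the
    explicit formulas at the ends too. Test functions are infinitely differentiable with compact
    support, so detecting a nonzero value takes an explicit bump, built from [exp (- / x)]. The
    variations themselves involve no exchange of limits: the Hamiltonian is quadratic, so it is a
    polynomial in [eps] along a line. *)

Fixpoint smooth (n : nat) (f : R -> R) : Prop :=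
  match n with
  | O => True
  | S m => (forall x : R, ex_derive f x) /\ smooth m (Derive f)
  end.

Lemma smooth_ext (n : nat) (f g : R -> R) :
  (forall x : R, f x = g x) -> smooth n f -> smooth n g.
Proof.
  revert f g; induction n as [|n IH]; intros f g Hfg; [easy|].
  intros [Hd Hs]; split.
  - intros x; apply ex_derive_ext with f; auto.
  - apply IH with (Derive f); [|exact Hs].
    intros x; apply Derive_ext; auto.
Qed.

Lemma smooth_S (n : nat) (f : R -> R) : smooth (S n) f -> smooth n f.
Proof.
  revert f; induction n as [|n IH]; intros f; [easy|].
  intros [Hd Hs]; split; [exact Hd|]; apply IH; exact Hs.
Qed.

(** [smooth] peels derivatives off next to [f], which suits inductions with the product rule,
    whereas [ex_derive_n] adds them on the outside; [Derive_n_comp] reconciles the two orders. *)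
Lemma smooth_ex_derive_n (n : nat) (f : R -> R) (x : R) :
  smooth n f -> ex_derive_n f n x.
Proof.
  destruct n as [|n]; [easy|]; simpl; revert f.
  induction n as [|n IH]; intros f [Hd Hs]; [exact (Hd x)|].
  apply ex_derive_ext with (Derive_n (Derive f) n); [|exact (IH _ Hs)].
  intros y; change (Derive f) with (Derive_n f 1).
  rewrite Derive_n_comp; now rewrite Nat.add_1_r.
Qed.

Lemma smooth_const (n : nat) (c : R) : smooth n (fun _ => c).
Proof.
  revert c; induction n as [|n IH]; intros c; [easy|]; split.
  - intros x; apply ex_derive_const.
  - apply smooth_ext with (fun _ => 0); [|apply IH].
    intros x; symmetry; apply Derive_const.
Qed.

Lemma smooth_plus (n : nat) (f g : R -> R) :
  smooth n f -> smooth n g -> smooth n (fun x => f x + g x).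
Proof.
  revert f g; induction n as [|n IH]; intros f g; [easy|].
  intros [Hf Sf] [Hg Sg]; split.
  - intros x; now apply @ex_derive_plus with (V := R_NormedModule).
  - apply smooth_ext with (fun x => Derive f x + Derive g x); [|auto].
    intros x; symmetry; now apply Derive_plus.
Qed.

Lemma smooth_mult (n : nat) (f g : R -> R) :
  smooth n f -> smooth n g -> smooth n (fun x => f x * g x).
Proof.
  revert f g; induction n as [|n IH]; intros f g; [easy|].
  (* The product rule leaves one factor undifferentiated in each term; the induction hypothesis uses
     it at the lower order. *)
  intros Hf Hg; pose proof (smooth_S _ _ Hf); pose proof (smooth_S _ _ Hg).
  destruct Hf as [Hf Sf], Hg as [Hg Sg]; split.
  - intros x; now apply ex_derive_mult.
  - apply smooth_ext with (fun x => Derive f x * g x + f x * Derive g x).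
    + intros x; symmetry; now apply Derive_mult.
    + apply smooth_plus; auto.
Qed.

Lemma smooth_comp_affine (n : nat) (f : R -> R) (k c : R) :
  smooth n f -> smooth n (fun x => f (k * x + c)).
Proof.
  revert f; induction n as [|n IH]; intros f; [easy|].
  intros [Hf Sf].
  assert (D : forall x : R, is_derive (fun x => f (k * x + c)) x
                              (k * Derive f (k * x + c))).
  { intros x; auto_derive; [auto|]; change (fun x => f x) with f; ring. }
  split.
  - intros x; eexists; apply D.
  - apply smooth_ext with (fun x => k * Derive f (k * x + c)).
    + intros x; symmetry; apply is_derive_unique, D.
    + apply smooth_mult; [apply smooth_const | now apply IH].
Qed.

(* The derivatives of [exp (- / x)] are combinations of the [flat k]. *)
Definition flat (k : nat) (x : R) : R :=
  if Rle_dec x 0 then 0 else (/ x) ^ k * exp (- / x).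

Lemma flat_nonpos (k : nat) (x : R) : x <= 0 -> flat k x = 0.
Proof. intros H; unfold flat; destruct (Rle_dec x 0); lra. Qed.

Lemma flat_pos (k : nat) (x : R) : 0 < x -> flat k x = (/ x) ^ k * exp (- / x).
Proof. intros H; unfold flat; destruct (Rle_dec x 0); lra. Qed.

Lemma flat_gt_0 (k : nat) (x : R) : 0 < x -> 0 < flat k x.
Proof.
  intros H; rewrite flat_pos by exact H.
  apply Rmult_lt_0_compat; [apply pow_lt, Rinv_0_lt_compat, H | apply exp_pos].
Qed.

(** For [y >= 0] the single term [y ^ k / k!] of the exponential series is at most [exp y], the
    other terms of the Taylor sum being nonnegative. *)
Lemma pow_exp_opp_le (k : nat) (y : R) : 0 <= y -> y ^ k * exp (- y) <= INR (fact k).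
Proof.
  intros Hy.
  assert (H : y ^ k / INR (fact k) <= exp y).
  { apply Rle_trans with (2 := exp_ge_taylor y k Hy).
    destruct k as [|k]; [apply Rle_refl|].
    rewrite tech5; rewrite <- (Rplus_0_l (_ / _)) at 1; apply Rplus_le_compat_r.
    apply cond_pos_sum; intros m.
    apply Rdiv_le_0_compat; [now apply pow_le | apply INR_fact_lt_0]. }
  pose proof (INR_fact_lt_0 k); pose proof (exp_pos y).
  rewrite exp_Ropp; apply Rle_div_l; [exact H1|].
  rewrite Rmult_comm; now apply Rle_div_l.
Qed.

(** The previous bound at exponent [2 + k] and [y = / x] leaves two spare powers of [/ x]. They give
    the factor [x ^ 2], which makes the difference quotient at 0 of order [x]. *)
Lemma flat_quadratic (k : nat) (x : R) :
  Rabs (flat k x) <= INR (fact (2 + k)) * x ^ 2.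
Proof.
  pose proof (INR_fact_lt_0 (2 + k)).
  destruct (Rle_lt_dec x 0) as [Hx|Hx].
  - rewrite flat_nonpos, Rabs_R0 by exact Hx; nra.
  - rewrite Rabs_pos_eq by (apply Rlt_le, flat_gt_0, Hx).
    rewrite flat_pos by exact Hx.
    pose proof (pow_exp_opp_le (2 + k) (/ x) (Rlt_le _ _ (Rinv_0_lt_compat _ Hx))) as B.
    rewrite pow_add in B.
    apply Rmult_le_compat_r with (r := x ^ 2) in B; [|apply pow2_ge_0].
    replace (_ * x ^ 2) with ((/ x) ^ k * exp (- / x)) in B at 1; [exact B|].
    field; lra.
Qed.

Lemma is_derive_flat (k : nat) (x : R) :
  is_derive (flat k) x (- INR k * flat (S k) x + flat (S (S k)) x).
Proof.
  destruct (Rtotal_order x 0) as [Hx|[->|Hx]].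
  - rewrite !flat_nonpos by lra.
    apply is_derive_ext_loc with (fun _ => 0).
    + apply (locally_interval _ x m_infty 0); [easy|exact Hx|].
      intros y _ Hy; simpl in Hy; rewrite flat_nonpos; lra.
    + replace (_ + _) with 0 by ring; apply @is_derive_const.
  - rewrite !flat_nonpos by lra; apply is_derive_Reals.
    intros eps Heps; set (C := INR (fact (2 + k))).
    assert (HC : 0 < C) by apply INR_fact_lt_0.
    (* The radius is [eps / C], since the difference quotient is at most [C * Rabs h]. *)
    exists (mkposreal _ (Rdiv_lt_0_compat _ _ Heps HC)); simpl; intros h Hh Hb.
    rewrite Rplus_0_l, (flat_nonpos k 0) by lra.
    replace (_ - _) with (flat k h / h) by (field; exact Hh).
    unfold Rdiv; rewrite Rabs_mult, Rabs_inv by exact Hh.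
    pose proof (Rabs_pos_lt _ Hh).
    apply Rlt_div_l; [exact H|].
    apply Rle_lt_trans with (1 := flat_quadratic k h); fold C.
    rewrite <- (pow2_abs h).
    apply Rlt_div_r in Hb; [|exact HC]; nra.
  - rewrite !flat_pos by exact Hx.
    apply is_derive_ext_loc with (fun x => (/ x) ^ k * exp (- / x)).
    + apply (locally_interval _ x 0 p_infty); [exact Hx|easy|].
      intros y Hy _; simpl in Hy; now rewrite flat_pos.
    + auto_derive; [lra|].
      (* Differentiating the power produces the exponent [pred k], so [k = 0] is treated apart. *)
      destruct k as [|k]; simpl pred; [simpl; field; lra|].
      rewrite <- !tech_pow_Rmult; field; lra.
Qed.

Lemma smooth_flat (n k : nat) : smooth n (flat k).
Proof.
  revert k; induction n as [|n IH]; intros k; [easy|]; split.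
  - intros x; eexists; apply is_derive_flat.
  - apply smooth_ext with (fun x => - INR k * flat (S k) x + flat (S (S k)) x).
    + intros x; symmetry; apply is_derive_unique, is_derive_flat.
    + apply smooth_plus; [apply smooth_mult; [apply smooth_const|]|]; apply IH.
Qed.

(** The arguments [x - c] and [d - x] are written in the affine shape of [smooth_comp_affine]. *)
Definition bump (c d x : R) : R := flat 0 (1 * x + - c) * flat 0 (-1 * x + d).

Lemma bump_gt_0 (c d x : R) : c < x < d -> 0 < bump c d x.
Proof. intros H; apply Rmult_lt_0_compat; apply flat_gt_0; lra. Qed.

Lemma bump_eq_0 (c d x : R) : x <= c \/ d <= x -> bump c d x = 0.
Proof.
  intros [H|H]; unfold bump.
  - rewrite (flat_nonpos 0 (1 * x + - c)) by lra; ring.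
  - rewrite (flat_nonpos 0 (-1 * x + d)) by lra; ring.
Qed.

Lemma bump_test_function (a b c d : R) :
  a < c -> d < b -> test_function a b (bump c d).
Proof.
  intros Hc Hd; split.
  - intros n x; apply smooth_ex_derive_n, smooth_mult;
      apply smooth_comp_affine, smooth_flat.
  - exists c, d; repeat split; [exact Hc | exact Hd | |];
      apply Rnot_lt_le; intros Hx; apply H, bump_eq_0; lra.
Qed.

Lemma test_function_ex_derive (a b : R) (eta : R -> R) (x : R) :
  test_function a b eta -> ex_derive eta x.
Proof. intros [Hs _]; exact (Hs 1%nat x). Qed.

Lemma test_function_continuous_Derive (a b : R) (eta : R -> R) (x : R) :
  test_function a b eta -> continuous (Derive eta) x.
Proof.
  intros [Hs _]; apply @ex_derive_continuous with (V := R_NormedModule).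
  exact (Hs 2%nat x).
Qed.

Lemma test_function_boundary (a b : R) (eta : R -> R) :
  test_function a b eta -> eta a = 0 /\ eta b = 0.
Proof.
  intros [_ (c & d & Hc & Hd & Hs)]; split.
  - destruct (Req_dec (eta a) 0) as [H|H]; [exact H|]; specialize (Hs _ H); lra.
  - destruct (Req_dec (eta b) 0) as [H|H]; [exact H|]; specialize (Hs _ H); lra.
Qed.

(** Nothing is known of [g] outside [[a, b]], and its continuity at the ends is one-sided. Yet the
    product is continuous on the whole line: off the support [[c, d]] it vanishes locally, and on
    the support, which lies inside []a, b[], relative continuity is ordinary continuity. *)
Lemma test_function_mult_continuous (a b : R) (g eta : R -> R) (x : R) :
  continuous_on (fun x => a <= x <= b) g -> test_function a b eta ->
  continuous (fun x => g x * eta x) x.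
Proof.
  intros Hg Ht; destruct (Ht) as [_ (c & d & Hc & Hd & Hs)].
  assert (Z : forall y, y < c \/ d < y -> eta y = 0).
  { intros y Hy; destruct (Req_dec (eta y) 0) as [H|H]; [exact H|].
    specialize (Hs _ H); lra. }
  assert (K : forall Q : R -> Prop, (forall y : R, Q y -> y < c \/ d < y) ->
            locally x Q -> continuous (fun x => g x * eta x) x).
  { intros Q HQ HL; apply continuous_ext_loc with (fun _ => 0);
      [|apply continuous_const].
    revert HL; apply filter_imp; intros y Hy; rewrite Z by auto.
    symmetry; apply Rmult_0_r. }
  destruct (Rlt_le_dec x c) as [H|H]; [|destruct (Rlt_le_dec d x) as [H'|H']].
  - apply K with (2 := open_lt c x H); auto.
  - apply K with (2 := open_gt d x H'); auto.
  - apply @continuous_mult with (K := R_AbsRing).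
    + apply (continuous_continuous_on (fun x => a <= x <= b)); [|exact Hg].
      apply (locally_interval _ x a b); simpl; intros; lra.
    + apply @ex_derive_continuous with (V := R_NormedModule).
      now apply test_function_ex_derive with a b.
Qed.

Lemma test_function_mult_ex_RInt (a b : R) (g eta : R -> R) :
  continuous_on (fun x => a <= x <= b) g -> test_function a b eta ->
  ex_RInt (fun x => g x * eta x) a b.
Proof.
  intros Hg Ht; apply (ex_RInt_continuous (V := R_CompleteNormedModule)).
  intros x _; now apply test_function_mult_continuous with a b.
Qed.

Lemma continuous_on_minus (D : R -> Prop) (f g : R -> R) :
  continuous_on D f -> continuous_on D g -> continuous_on D (fun x => f x - g x).
Proof.
  intros Hf Hg x Hx.
  apply (filterlim_comp_2 (G := locally (f x)) (H := locally (- g x)))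
     with (f := f) (g := fun y => - g y) (h := Rplus).
  - now apply Hf.
  - apply filterlim_comp with (G := locally (g x)) (1 := Hg x Hx).
    apply (filterlim_opp (V := R_NormedModule)).
  - apply (filterlim_plus (V := R_NormedModule)).
Qed.

Lemma RInt_ext_R (f g : R -> R) (a b : R) :
  (forall x : R, f x = g x) -> RInt f a b = RInt g a b.
Proof. intros H; apply RInt_ext; auto. Qed.

Lemma RInt_minus_R (f g : R -> R) (a b : R) :
  ex_RInt f a b -> ex_RInt g a b ->
  RInt (fun x => f x - g x) a b = RInt f a b - RInt g a b.
Proof. exact (RInt_minus (V := R_CompleteNormedModule) f g a b). Qed.

(* A bump supported where [g] keeps the sign of [g x <> 0] gives a nonzero integral. *)
Lemma fundamental_lemma_interior (a b : R) (g : R -> R) :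
  continuous_on (fun x => a <= x <= b) g ->
  (forall eta : R -> R, test_function a b eta -> RInt (fun x => g x * eta x) a b = 0) ->
  forall x : R, a < x < b -> g x = 0.
Proof.
  intros Hg H0 x Hx.
  destruct (Req_dec (g x) 0) as [E|E]; [exact E|exfalso].
  assert (Cg : forall y, a < y < b -> continuous g y).
  { intros y Hy; apply (continuous_continuous_on (fun x => a <= x <= b)); [|exact Hg].
    apply (locally_interval _ y a b); simpl; intros; lra. }
  assert (L : locally x (fun y => a < y < b /\ 0 < g x * g y)).
  { apply filter_and.
    - apply (locally_interval _ x a b); simpl; intros; lra.
    - assert (C : continuous (fun y => g x * g y) x).
      { apply @continuous_mult with (K := R_AbsRing);
          [apply continuous_const | now apply Cg]. }
      apply C, (open_gt 0 (g x * g x)); nra. }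
  destruct L as [[r Hr] L]; simpl in L.
  (* Half the radius, so that the closed interval [[c, d]] stays inside the ball given by [L]. *)
  set (c := x - r / 2); set (d := x + r / 2).
  assert (Lcd : forall y, c <= y <= d -> a < y < b /\ 0 < g x * g y).
  { intros y Hy; apply L; change (Rabs (y - x) < r); apply Rabs_def1;
      unfold c, d in Hy; lra. }
  assert (Hcd : c < d) by (unfold c, d; lra).
  destruct (Lcd c) as [Hc _]; [lra|]; destruct (Lcd d) as [Hd _]; [lra|].
  pose proof (bump_test_function a b c d (proj1 Hc) (proj2 Hd)) as Ht.
  set (h := fun y => g y * bump c d y).
  assert (Ch : forall y, continuous h y).
  { intros y; now apply test_function_mult_continuous with a b. }
  assert (Eh : forall u v : R, ex_RInt h u v).
  { intros u v; apply (ex_RInt_continuous (V := R_CompleteNormedModule)); auto. }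
  assert (Z : forall u v, u <= v -> (v <= c \/ d <= u) -> RInt h u v = 0).
  { intros u v Huv Ho; rewrite (RInt_ext (V := R_CompleteNormedModule) h (fun _ => 0)).
    - rewrite RInt_const; apply Rmult_0_r.
    - intros y; rewrite Rmin_left, Rmax_right by exact Huv; intros Hy.
      unfold h; rewrite bump_eq_0 by lra; apply Rmult_0_r. }
  (* The constant factor [g x] makes the integrand positive whatever the sign of [g], so both cases
     are treated at once. *)
  assert (Hpos : 0 < RInt (fun y => g x * h y) c d).
  { apply RInt_gt_0; [exact Hcd | |].
    - intros y Hy; unfold h; rewrite <- Rmult_assoc.
      apply Rmult_lt_0_compat; [apply Lcd; lra | now apply bump_gt_0].
    - intros y _; apply @continuous_mult with (K := R_AbsRing);
        [apply continuous_const | apply Ch]. }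
  pose proof (RInt_scal (V := R_CompleteNormedModule) h c d (g x) (Eh c d)) as S.
  change (RInt (fun y => g x * h y) c d = g x * RInt h c d) in S.
  pose proof (RInt_Chasles (V := R_CompleteNormedModule) h a c b (Eh _ _) (Eh _ _)) as C1.
  pose proof (RInt_Chasles (V := R_CompleteNormedModule) h c d b (Eh _ _) (Eh _ _)) as C2.
  change (RInt h a c + RInt h c b = RInt h a b) in C1.
  change (RInt h c d + RInt h d b = RInt h c b) in C2.
  pose proof (H0 _ Ht) as H1; fold h in H1.
  rewrite (Z a c) in C1 by lra; rewrite (Z d b) in C2 by lra.
  assert (RInt h c d = 0) by lra.
  rewrite S, H, Rmult_0_r in Hpos; lra.
Qed.

Lemma continuous_on_eq_0_closure (a b : R) (g : R -> R) :
  a < b -> continuous_on (fun x => a <= x <= b) g ->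
  (forall x : R, a < x < b -> g x = 0) ->
  forall x : R, a <= x <= b -> g x = 0.
Proof.
  intros Hab Hg Hz x Hx.
  destruct (Req_dec (g x) 0) as [E|E]; [exact E|exfalso].
  assert (L : locally (g x) (fun z => z <> 0)) by now apply open_neq.
  destruct (Hg x Hx _ L) as [[r Hr] K]; simpl in K.
  (* A point within [r] of [x], moved towards the farther end by at most a quarter of the length,
     hence strictly inside the interval even when [x] is an endpoint. *)
  set (y := if Rlt_dec x ((a + b) / 2) then x + Rmin (r / 2) ((b - a) / 4)
            else x - Rmin (r / 2) ((b - a) / 4)).
  assert (Hm : 0 < Rmin (r / 2) ((b - a) / 4)) by (apply Rmin_pos; lra).
  pose proof (Rmin_l (r / 2) ((b - a) / 4)); pose proof (Rmin_r (r / 2) ((b - a) / 4)).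
  assert (Hy : a < y < b /\ Rabs (y - x) < r).
  { unfold y; destruct (Rlt_dec x ((a + b) / 2));
      (split; [lra | apply Rabs_def1; lra]). }
  apply (K y); [exact (proj2 Hy) | lra | apply Hz, Hy].
Qed.

Lemma fundamental_lemma (a b : R) (f g : R -> R) :
  a < b ->
  continuous_on (fun x => a <= x <= b) f -> continuous_on (fun x => a <= x <= b) g ->
  (forall eta : R -> R, test_function a b eta ->
     RInt (fun x => f x * eta x) a b = RInt (fun x => g x * eta x) a b) ->
  forall x : R, a <= x <= b -> f x = g x.
Proof.
  intros Hab Hf Hg H x Hx; apply Rminus_diag_uniq.
  pose proof (continuous_on_minus _ _ _ Hf Hg) as Hfg.
  apply (continuous_on_eq_0_closure a b (fun x => f x - g x)); try assumption.
  apply fundamental_lemma_interior; [exact Hfg|]; intros eta Ht.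
  rewrite (RInt_ext_R _ (fun x => f x * eta x - g x * eta x)) by (intros y; ring).
  rewrite RInt_minus_R by now apply test_function_mult_ex_RInt.
  rewrite H by exact Ht; apply Rminus_diag.
Qed.

(** * Continuity and C^1 functions on an interval *)

Lemma continuous_Rplus {U : UniformSpace} (f g : U -> R) (x : U) :
  continuous f x -> continuous g x -> continuous (fun y => f y + g y) x.
Proof. exact (continuous_plus (V := R_NormedModule) f g x). Qed.

Lemma continuous_Rminus {U : UniformSpace} (f g : U -> R) (x : U) :
  continuous f x -> continuous g x -> continuous (fun y => f y - g y) x.
Proof. exact (continuous_minus (V := R_NormedModule) f g x). Qed.

Lemma continuous_Ropp {U : UniformSpace} (f : U -> R) (x : U) :
  continuous f x -> continuous (fun y => - f y) x.
Proof. exact (continuous_opp (V := R_NormedModule) f x). Qed.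

Lemma continuous_Rmult {U : UniformSpace} (f g : U -> R) (x : U) :
  continuous f x -> continuous g x -> continuous (fun y => f y * g y) x.
Proof. exact (continuous_mult (K := R_AbsRing) f g x). Qed.

Lemma continuous_Rsqr {U : UniformSpace} (f : U -> R) (x : U) :
  continuous f x -> continuous (fun y => f y ^ 2) x.
Proof.
  intros Hf; apply continuous_ext with (fun y => f y * f y);
    [intros y; simpl; ring | now apply continuous_Rmult].
Qed.

(* The goal is matched syntactically: plain [apply] would look for sums and
   products by unfolding the functions at the leaves. *)
Ltac continuity_R :=
  lazymatch goal with
  | |- continuous (fun _ => ?c) _ => apply continuous_const
  | |- continuous (fun y => @?f y + @?g y) _ =>
      apply (continuous_Rplus f g); continuity_R
  | |- continuous (fun y => @?f y - @?g y) _ =>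
      apply (continuous_Rminus f g); continuity_R
  | |- continuous (fun y => - @?f y) _ => apply (continuous_Ropp f); continuity_R
  | |- continuous (fun y => @?f y * @?g y) _ =>
      apply (continuous_Rmult f g); continuity_R
  | |- continuous (fun y => @?f y ^ 2) _ => apply (continuous_Rsqr f); continuity_R
  | |- _ => assumption
  end.

Lemma ex_derive_continuous_R (f : R -> R) (x : R) : ex_derive f x -> continuous f x.
Proof. exact (ex_derive_continuous (V := R_NormedModule) f x). Qed.

Lemma C1_on_interval_ex_derive (a b : R) (f : R -> R) (x : R) :
  C1_on_interval a b f -> a <= x <= b -> ex_derive f x.
Proof. intros Hf Hx; exact (proj1 (locally_singleton _ _ (Hf x Hx))). Qed.

Lemma C1_on_interval_continuous_Derive (a b : R) (f : R -> R) (x : R) :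
  C1_on_interval a b f -> a <= x <= b -> continuous (Derive f) x.
Proof. intros Hf Hx; exact (proj2 (locally_singleton _ _ (Hf x Hx))). Qed.

Lemma C1_on_interval_continuous (a b : R) (f : R -> R) (x : R) :
  C1_on_interval a b f -> a <= x <= b -> continuous f x.
Proof.
  intros Hf Hx; now apply ex_derive_continuous_R, C1_on_interval_ex_derive with a b.
Qed.

Lemma C1_on_interval_plus (a b : R) (f g : R -> R) :
  C1_on_interval a b f -> C1_on_interval a b g ->
  C1_on_interval a b (fun x => f x + g x).
Proof.
  intros Hf Hg x Hx.
  pose proof (filter_and _ _ (Hf x Hx) (Hg x Hx)) as L.
  (* Continuity of the derivative at [y] is transferred along the sum rule, which must therefore
     hold on a neighbourhood of [y] and not just at [y]. *)
  apply locally_locally in L; revert L; apply filter_imp; intros y L.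
  pose proof (locally_singleton _ _ L) as [[Df Cf] [Dg Cg]]; split.
  - now apply (ex_derive_plus (V := R_NormedModule)).
  - apply continuous_ext_loc with (fun z => Derive f z + Derive g z).
    + revert L; apply filter_imp; intros z [[? _] [? _]]; symmetry.
      now apply Derive_plus.
    + now apply continuous_Rplus.
Qed.

Lemma C1_on_interval_opp (a b : R) (f : R -> R) :
  C1_on_interval a b f -> C1_on_interval a b (fun x => - f x).
Proof.
  intros Hf x Hx.
  pose proof (Hf x Hx) as L; revert L; apply filter_imp; intros y [Df Cf]; split.
  - now apply (ex_derive_opp (V := R_NormedModule)).
  - apply continuous_ext with (fun z => - Derive f z).
    + intros z; symmetry; apply Derive_opp.
    + now apply continuous_Ropp.
Qed.

Lemma C1_on_interval_minus (a b : R) (f g : R -> R) :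
  C1_on_interval a b f -> C1_on_interval a b g ->
  C1_on_interval a b (fun x => f x - g x).
Proof. intros Hf Hg; apply C1_on_interval_plus, C1_on_interval_opp; assumption. Qed.

Lemma C1_on_interval_mult (a b : R) (f g : R -> R) :
  C1_on_interval a b f -> C1_on_interval a b g ->
  C1_on_interval a b (fun x => f x * g x).
Proof.
  intros Hf Hg x Hx.
  pose proof (filter_and _ _ (Hf x Hx) (Hg x Hx)) as L.
  apply locally_locally in L; revert L; apply filter_imp; intros y L.
  pose proof (locally_singleton _ _ L) as [[Df Cf] [Dg Cg]]; split.
  - now apply ex_derive_mult.
  - apply continuous_ext_loc with (fun z => Derive f z * g z + f z * Derive g z).
    + revert L; apply filter_imp; intros z [[? _] [? _]]; symmetry.
      now apply Derive_mult.
    + pose proof (ex_derive_continuous_R _ _ Df).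
      pose proof (ex_derive_continuous_R _ _ Dg).
      continuity_R.
Qed.

(** * Integration by parts and integrals quadratic in a parameter *)

Lemma ex_RInt_continuous_R (f : R -> R) (a b : R) :
  a <= b -> (forall x : R, a <= x <= b -> continuous f x) -> ex_RInt f a b.
Proof.
  intros Hab Hf; apply (ex_RInt_continuous (V := R_CompleteNormedModule)).
  intros z; rewrite Rmin_left, Rmax_right by exact Hab; apply Hf.
Qed.

Lemma RInt_derivative (a b : R) (f df : R -> R) :
  a <= b ->
  (forall x : R, a <= x <= b -> is_derive f x (df x)) ->
  (forall x : R, a <= x <= b -> continuous df x) ->
  RInt df a b = f b - f a.
Proof.
  intros Hab Hf Hdf; apply is_RInt_unique.
  apply (is_RInt_derive (V := R_CompleteNormedModule) f df); intros x;
    rewrite Rmin_left, Rmax_right by exact Hab; auto.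
Qed.

(** The difference of the two integrands is the derivative of [f * eta], and [eta] vanishes at both
    ends, so no boundary term survives whatever the boundary values of [f]. *)
Lemma RInt_by_parts_test (a b : R) (f eta : R -> R) :
  a <= b -> C1_on_interval a b f -> test_function a b eta ->
  RInt (fun x => f x * Derive eta x) a b = RInt (fun x => - Derive f x * eta x) a b.
Proof.
  intros Hab Hf Ht.
  assert (Ce : forall x, continuous eta x).
  { intros x; now apply ex_derive_continuous_R, test_function_ex_derive with a b. }
  assert (Cde : forall x, continuous (Derive eta) x).
  { intros x; now apply test_function_continuous_Derive with a b. }
  assert (C1 : forall x, a <= x <= b -> continuous (fun x => f x * Derive eta x) x).
  { intros x Hx; pose proof (C1_on_interval_continuous a b f x Hf Hx).
    apply continuous_Rmult; auto. }
  assert (C2 : forall x, a <= x <= b -> continuous (fun x => - Derive f x * eta x) x).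
  { intros x Hx; pose proof (C1_on_interval_continuous_Derive a b f x Hf Hx).
    apply continuous_Rmult, Ce; now apply continuous_Ropp. }
  apply Rminus_diag_uniq.
  rewrite <- RInt_minus_R by now apply ex_RInt_continuous_R.
  rewrite (RInt_derivative a b (fun x => f x * eta x)).
  - destruct (test_function_boundary _ _ _ Ht) as [-> ->]; ring.
  - exact Hab.
  - intros x Hx; pose proof (C1_on_interval_ex_derive a b f x Hf Hx).
    pose proof (test_function_ex_derive a b eta x Ht).
    auto_derive; [auto|].
    change (fun x => f x) with f; change (fun x => eta x) with eta; ring.
  - intros x Hx; apply continuous_Rminus; auto.
Qed.

(** By linearity the integral is a polynomial in [eps] with constant coefficients; its derivative at
    0 is the linear one. *)
Lemma is_derive_RInt_quadratic (a b : R) (q0 q1 q2 : R -> R) :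
  a <= b ->
  (forall x : R, a <= x <= b -> continuous q0 x) ->
  (forall x : R, a <= x <= b -> continuous q1 x) ->
  (forall x : R, a <= x <= b -> continuous q2 x) ->
  is_derive (fun eps => RInt (fun x => q0 x + eps * q1 x + eps ^ 2 * q2 x) a b) 0
    (RInt q1 a b).
Proof.
  intros Hab H0 H1 H2.
  pose proof (RInt_correct (V := R_CompleteNormedModule)) as I.
  apply (ex_RInt_continuous_R _ _ _ Hab), I in H0.
  apply (ex_RInt_continuous_R _ _ _ Hab), I in H1.
  apply (ex_RInt_continuous_R _ _ _ Hab), I in H2.
  apply is_derive_ext with
    (fun eps => RInt q0 a b + eps * RInt q1 a b + eps ^ 2 * RInt q2 a b).
  - intros eps; symmetry; apply is_RInt_unique.
    apply (is_RInt_plus (V := R_NormedModule)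
             (fun x => q0 x + eps * q1 x) (fun x => eps ^ 2 * q2 x)).
    + apply (is_RInt_plus (V := R_NormedModule) q0 (fun x => eps * q1 x)); [exact H0|].
      now apply (is_RInt_scal (V := R_NormedModule)).
    + now apply (is_RInt_scal (V := R_NormedModule)).
  - generalize (RInt q0 a b) (RInt q1 a b) (RInt q2 a b); intros c0 c1 c2.
    auto_derive; [easy|]; ring.
Qed.

Lemma regular_on_mult (a b : R) (f g : R -> R) :
  regular_on a b f -> regular_on a b g -> regular_on a b (fun x => f x * g x).
Proof.
  intros [Pf Cf] [Pg Cg]; split; [|now apply C1_on_interval_mult].
  intros x Hx; apply Rmult_lt_0_compat; auto.
Qed.

Lemma regular_on_continuous_inv (a b : R) (f : R -> R) (x : R) :
  regular_on a b f -> a <= x <= b -> continuous (fun y => / f y) x.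
Proof.
  intros [Pf Cf] Hx; apply continuous_comp.
  - now apply C1_on_interval_continuous with a b.
  - apply ex_derive_continuous_R; specialize (Pf x Hx); auto_derive; lra.
Qed.

Lemma admissible_C1_on_interval (a b : R) (P : params) :
  admissible a b P ->
  C1_on_interval a b (T0 P) /\ C1_on_interval a b (EI P) /\ C1_on_interval a b (AkG P).
Proof.
  intros (Hr & Ha & [_ HT] & Hk & Hs & Hi & Hy); split; [exact HT|].
  split.
  - apply (C1_on_interval_mult a b (young P) (inertia P)); [apply Hy | apply Hi].
  - apply (C1_on_interval_mult a b (fun x => area P x * kappa P x) (shear P));
      [apply (C1_on_interval_mult a b (area P) (kappa P)); [apply Ha | apply Hk]
      | apply Hs].
Qed.

Lemma admissible_continuous_inv (a b : R) (P : params) (x : R) :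
  admissible a b P -> a <= x <= b ->
  continuous (fun y => / (rho P y * area P y)) x
  /\ continuous (fun y => / (rho P y * inertia P y)) x.
Proof.
  intros (Hr & Ha & _ & _ & _ & Hi & _) Hx.
  split; apply regular_on_continuous_inv with a b;
    auto using regular_on_mult.
Qed.

(** * Variations of the Hamiltonian *)

Definition shear_force (P : params) (w phi : R -> R) (x : R) : R :=
  AkG P x * (Derive w x - phi x).

(** All four arguments are varied at once; each partial variation is then the case where the other
    three directions are zero. The directions need not vanish at the ends, since nothing is
    integrated by parts yet. *)
Lemma is_derive_hamiltonian (a b : R) (P : params)
    (w pw phi pphi dw dpw dphi dpphi : R -> R) :
  a <= b -> admissible a b P ->
  C1_on_interval a b w -> C1_on_interval a b phi ->
  C1_on_interval a b dw -> C1_on_interval a b dphi ->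
  (forall x : R, a <= x <= b -> continuous pw x) ->
  (forall x : R, a <= x <= b -> continuous pphi x) ->
  (forall x : R, a <= x <= b -> continuous dpw x) ->
  (forall x : R, a <= x <= b -> continuous dpphi x) ->
  is_derive (fun eps => hamiltonian a b P
      (fun x => w x + eps * dw x) (fun x => pw x + eps * dpw x)
      (fun x => phi x + eps * dphi x) (fun x => pphi x + eps * dpphi x)) 0
    (RInt (fun x =>
        / (rho P x * area P x) * pw x * dpw x
        + / (rho P x * inertia P x) * pphi x * dpphi x
        + T0 P x * Derive w x * Derive dw x
        + EI P x * Derive phi x * Derive dphi x
        + shear_force P w phi x * (Derive dw x - dphi x)) a b).
Proof.
  intros Hab HP Hw Hphi Hdw Hdphi Hpw Hpphi Hdpw Hdpphi.
  destruct (admissible_C1_on_interval a b P HP) as (HT & HE & HA).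
  (* Coefficients of the perturbed density: [q0] and [q2] keep the factor one half, while in the
     linear coefficient [q1] it is cancelled by the double product of each square. *)
  set (q0 := fun x => / 2 *
      (/ (rho P x * area P x) * pw x ^ 2
      + / (rho P x * inertia P x) * pphi x ^ 2
      + T0 P x * Derive w x ^ 2
      + EI P x * Derive phi x ^ 2
      + AkG P x * (Derive w x - phi x) ^ 2)).
  set (q2 := fun x => / 2 *
      (/ (rho P x * area P x) * dpw x ^ 2
      + / (rho P x * inertia P x) * dpphi x ^ 2
      + T0 P x * Derive dw x ^ 2
      + EI P x * Derive dphi x ^ 2
      + AkG P x * (Derive dw x - dphi x) ^ 2)).
  match goal with |- is_derive _ _ (RInt ?f _ _) => set (q1 := f) end.
  assert (C : forall x, a <= x <= b ->
            continuous q0 x /\ continuous q1 x /\ continuous q2 x).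
  { intros x Hx; destruct (admissible_continuous_inv a b P x HP Hx) as [? ?].
    pose proof (C1_on_interval_continuous a b _ x HT Hx).
    pose proof (C1_on_interval_continuous a b _ x HE Hx).
    pose proof (C1_on_interval_continuous a b _ x HA Hx).
    pose proof (C1_on_interval_continuous a b _ x Hphi Hx).
    pose proof (C1_on_interval_continuous a b _ x Hdphi Hx).
    pose proof (C1_on_interval_continuous_Derive a b _ x Hw Hx).
    pose proof (C1_on_interval_continuous_Derive a b _ x Hphi Hx).
    pose proof (C1_on_interval_continuous_Derive a b _ x Hdw Hx).
    pose proof (C1_on_interval_continuous_Derive a b _ x Hdphi Hx).
    pose proof (Hpw x Hx); pose proof (Hpphi x Hx).
    pose proof (Hdpw x Hx); pose proof (Hdpphi x Hx).
    unfold q0, q1, q2, shear_force; repeat split; continuity_R. }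
  apply is_derive_ext with
    (fun eps => RInt (fun x => q0 x + eps * q1 x + eps ^ 2 * q2 x) a b).
  2: now apply is_derive_RInt_quadratic; [exact Hab | apply C..].
  intros eps; unfold hamiltonian; symmetry.
  (* The factor 2 is moved to the polynomial side and then under its integral, leaving an equality
     of integrands. *)
  apply Rmult_eq_reg_l with 2; [|lra].
  rewrite <- Rmult_assoc, Rinv_r, Rmult_1_l by lra.
  assert (E : ex_RInt (fun x => q0 x + eps * q1 x + eps ^ 2 * q2 x) a b).
  { apply ex_RInt_continuous_R; [exact Hab|]; intros x Hx.
    destruct (C x Hx) as (? & ? & ?); continuity_R. }
  pose proof (RInt_scal (V := R_CompleteNormedModule) _ a b 2 E) as S.
  apply eq_trans with (2 := S).
  apply RInt_ext; intros x; rewrite Rmin_left, Rmax_right by exact Hab; intros Hx.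
  assert (Hx' : a <= x <= b) by lra.
  assert (D : forall f g : R -> R, C1_on_interval a b f -> C1_on_interval a b g ->
            Derive (fun x => f x + eps * g x) x = Derive f x + eps * Derive g x).
  { intros f g Hf Hg.
    pose proof (C1_on_interval_ex_derive a b f x Hf Hx').
    pose proof (C1_on_interval_ex_derive a b g x Hg Hx').
    apply is_derive_unique; auto_derive; [auto|].
    change (fun x => f x) with f; change (fun x => g x) with g; ring. }
  rewrite !D by assumption.
  unfold q0, q1, q2, shear_force, scal; simpl; unfold mult; simpl; field.
  destruct HP as ([Hr _] & [Ha _] & _ & _ & _ & [Hi _] & _).
  specialize (Hr x Hx'); specialize (Ha x Hx'); specialize (Hi x Hx'); lra.
Qed.

(** Perturbing by [eps * 0] gives a function only pointwise equal to the original one; this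
    identifies the two inside the Hamiltonian without functional extensionality. *)
Lemma hamiltonian_ext (a b : R) (P : params) (w pw phi pphi w' pw' phi' pphi' : R -> R) :
  (forall x : R, w x = w' x) -> (forall x : R, pw x = pw' x) ->
  (forall x : R, phi x = phi' x) -> (forall x : R, pphi x = pphi' x) ->
  hamiltonian a b P w pw phi pphi = hamiltonian a b P w' pw' phi' pphi'.
Proof.
  intros Ew Epw Ephi Epphi; unfold hamiltonian; f_equal.
  apply RInt_ext; intros x _.
  now rewrite (Derive_ext _ _ x Ew), (Derive_ext _ _ x Ephi), Epw, Ephi, Epphi.
Qed.

Lemma C1_on_interval_const (a b c : R) : C1_on_interval a b (fun _ => c).
Proof.
  intros x _; apply filter_forall; intros y; split; [apply ex_derive_const|].
  apply continuous_ext with (fun _ => 0); [|apply continuous_const].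
  intros z; symmetry; apply Derive_const.
Qed.

Lemma test_function_C1_on_interval (a b : R) (eta : R -> R) :
  test_function a b eta -> C1_on_interval a b eta.
Proof.
  intros Ht x _; apply filter_forall; intros y; split.
  - now apply test_function_ex_derive with a b.
  - now apply test_function_continuous_Derive with a b.
Qed.

(** Both integrals are the derivative at 0 of the same function of [eps], so [g] and [h] agree
    against every test function. *)
Lemma weak_variational_derivative_unique (a b : R) (F : (R -> R) -> R) (u g h : R -> R) :
  a < b ->
  is_weak_variational_derivative a b F u g ->
  is_weak_variational_derivative a b F u h ->
  forall x : R, a <= x <= b -> g x = h x.
Proof.
  intros Hab [Cg Dg] [Ch Dh].
  apply fundamental_lemma; [exact Hab | exact Cg | exact Ch |].
  intros eta Ht; rewrite <- (is_derive_unique _ _ _ (Dg eta Ht)).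
  exact (is_derive_unique _ _ _ (Dh eta Ht)).
Qed.

(** The displacements get two derivatives because the forces built on their slopes are
    differentiated once more; the momenta enter algebraically. *)
Definition static_regular (a b : R) (w pw phi pphi : R -> R) : Prop :=
  C1_on_interval a b w /\ C1_on_interval a b (Derive w)
  /\ C1_on_interval a b phi /\ C1_on_interval a b (Derive phi)
  /\ (forall x : R, a <= x <= b -> continuous pw x)
  /\ (forall x : R, a <= x <= b -> continuous pphi x).

Definition transverse_force (P : params) (w phi : R -> R) (x : R) : R :=
  T0 P x * Derive w x + shear_force P w phi x.

Definition bending_moment (P : params) (phi : R -> R) (x : R) : R :=
  EI P x * Derive phi x.

Lemma shear_force_C1_on_interval (a b : R) (P : params) (w phi : R -> R) :
  admissible a b P -> C1_on_interval a b (Derive w) -> C1_on_interval a b phi ->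
  C1_on_interval a b (shear_force P w phi).
Proof.
  intros HP Hw Hphi; destruct (admissible_C1_on_interval a b P HP) as (_ & _ & HA).
  apply (C1_on_interval_mult a b (AkG P) (fun x => Derive w x - phi x)); [exact HA|].
  now apply C1_on_interval_minus.
Qed.

Lemma transverse_force_C1_on_interval (a b : R) (P : params) (w phi : R -> R) :
  admissible a b P -> C1_on_interval a b (Derive w) -> C1_on_interval a b phi ->
  C1_on_interval a b (transverse_force P w phi).
Proof.
  intros HP Hw Hphi; destruct (admissible_C1_on_interval a b P HP) as (HT & _ & _).
  apply (C1_on_interval_plus a b (fun x => T0 P x * Derive w x)).
  - now apply C1_on_interval_mult.
  - now apply shear_force_C1_on_interval.
Qed.

Lemma bending_moment_C1_on_interval (a b : R) (P : params) (phi : R -> R) :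
  admissible a b P -> C1_on_interval a b (Derive phi) ->
  C1_on_interval a b (bending_moment P phi).
Proof.
  intros HP Hphi; destruct (admissible_C1_on_interval a b P HP) as (_ & HE & _).
  now apply C1_on_interval_mult.
Qed.

Lemma test_function_continuous (a b : R) (eta : R -> R) (x : R) :
  test_function a b eta -> continuous eta x.
Proof. intros Ht; now apply ex_derive_continuous_R, test_function_ex_derive with a b. Qed.

(** The momentum enters the density without an [x]-derivative, so the variation is already an
    integral against [eta]. *)
Lemma weak_variational_derivative_pw (a b : R) (P : params) (w pw phi pphi : R -> R) :
  a <= b -> admissible a b P -> static_regular a b w pw phi pphi ->
  is_weak_variational_derivative a b (fun u => hamiltonian a b P w u phi pphi) pw
    (fun x => / (rho P x * area P x) * pw x).
Proof.
  intros Hab HP (Hw & Hdw & Hphi & Hdphi & Hpw & Hpphi); split.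
  - apply continuous_on_forall; intros x Hx; apply continuous_Rmult; auto.
    now apply admissible_continuous_inv with a b.
  - intros eta Ht.
    assert (Z := C1_on_interval_const a b 0).
    assert (Ce := fun x (_ : a <= x <= b) => test_function_continuous a b eta x Ht).
    assert (Cz := fun x (_ : a <= x <= b) => continuous_const (0 : R) x).
    pose proof (is_derive_hamiltonian a b P w pw phi pphi (fun _ => 0) eta (fun _ => 0)
                  (fun _ => 0) Hab HP Hw Hphi Z Z Hpw Hpphi Ce Cz) as D.
    rewrite (RInt_ext_R _ (fun x => / (rho P x * area P x) * pw x * eta x)) in D.
    + revert D; apply is_derive_ext; intros eps.
      apply hamiltonian_ext; intros x; ring.
    + intros x; rewrite Derive_const; ring.
Qed.

Lemma weak_variational_derivative_pphi (a b : R) (P : params) (w pw phi pphi : R -> R) :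
  a <= b -> admissible a b P -> static_regular a b w pw phi pphi ->
  is_weak_variational_derivative a b (fun u => hamiltonian a b P w pw phi u) pphi
    (fun x => / (rho P x * inertia P x) * pphi x).
Proof.
  intros Hab HP (Hw & Hdw & Hphi & Hdphi & Hpw & Hpphi); split.
  - apply continuous_on_forall; intros x Hx; apply continuous_Rmult; auto.
    now apply admissible_continuous_inv with a b.
  - intros eta Ht.
    assert (Z := C1_on_interval_const a b 0).
    assert (Ce := fun x (_ : a <= x <= b) => test_function_continuous a b eta x Ht).
    assert (Cz := fun x (_ : a <= x <= b) => continuous_const (0 : R) x).
    pose proof (is_derive_hamiltonian a b P w pw phi pphi (fun _ => 0) (fun _ => 0)
                  (fun _ => 0) eta Hab HP Hw Hphi Z Z Hpw Hpphi Cz Ce) as D.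
    rewrite (RInt_ext_R _ (fun x => / (rho P x * inertia P x) * pphi x * eta x)) in D.
    + revert D; apply is_derive_ext; intros eps.
      apply hamiltonian_ext; intros x; ring.
    + intros x; rewrite Derive_const; ring.
Qed.

(** Only [Derive eta] occurs in the variation, and its coefficient, tension plus shear, is the
    transverse force; one integration by parts concludes. *)
Lemma weak_variational_derivative_w (a b : R) (P : params) (w pw phi pphi : R -> R) :
  a <= b -> admissible a b P -> static_regular a b w pw phi pphi ->
  is_weak_variational_derivative a b (fun u => hamiltonian a b P u pw phi pphi) w
    (fun x => - Derive (transverse_force P w phi) x).
Proof.
  intros Hab HP (Hw & Hdw & Hphi & Hdphi & Hpw & Hpphi).
  assert (HF := transverse_force_C1_on_interval a b P w phi HP Hdw Hphi).
  split.
  - apply continuous_on_forall; intros x Hx; apply continuous_Ropp.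
    now apply C1_on_interval_continuous_Derive with a b.
  - intros eta Ht.
    assert (Z := C1_on_interval_const a b 0).
    assert (He := test_function_C1_on_interval a b eta Ht).
    assert (Cz := fun x (_ : a <= x <= b) => continuous_const (0 : R) x).
    pose proof (is_derive_hamiltonian a b P w pw phi pphi eta (fun _ => 0)
                  (fun _ => 0) (fun _ => 0) Hab HP Hw Hphi He Z Hpw Hpphi Cz Cz) as D.
    rewrite <- RInt_by_parts_test by assumption.
    rewrite (RInt_ext_R _ (fun x => transverse_force P w phi x * Derive eta x)) in D.
    + revert D; apply is_derive_ext; intros eps.
      apply hamiltonian_ext; intros x; ring.
    + intros x; rewrite Derive_const; unfold transverse_force; ring.
Qed.

(** The rotation enters both through its slope and directly through the shear. The integral is split
    so that only the bending part is integrated by parts, which is what the integrability facts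
    [E1], [E2] and [E3] serve. *)
Lemma weak_variational_derivative_phi (a b : R) (P : params) (w pw phi pphi : R -> R) :
  a <= b -> admissible a b P -> static_regular a b w pw phi pphi ->
  is_weak_variational_derivative a b (fun u => hamiltonian a b P w pw u pphi) phi
    (fun x => - Derive (bending_moment P phi) x - shear_force P w phi x).
Proof.
  intros Hab HP (Hw & Hdw & Hphi & Hdphi & Hpw & Hpphi).
  assert (HM := bending_moment_C1_on_interval a b P phi HP Hdphi).
  assert (HS := shear_force_C1_on_interval a b P w phi HP Hdw Hphi).
  split.
  - apply continuous_on_forall; intros x Hx.
    apply continuous_Rminus; [apply continuous_Ropp|].
    + now apply C1_on_interval_continuous_Derive with a b.
    + now apply C1_on_interval_continuous with a b.
  - intros eta Ht.
    assert (Z := C1_on_interval_const a b 0).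
    assert (He := test_function_C1_on_interval a b eta Ht).
    assert (Cz := fun x (_ : a <= x <= b) => continuous_const (0 : R) x).
    pose proof (is_derive_hamiltonian a b P w pw phi pphi (fun _ => 0) (fun _ => 0)
                  eta (fun _ => 0) Hab HP Hw Hphi Z He Hpw Hpphi Cz Cz) as D.
    assert (C : forall x, a <= x <= b ->
              continuous (fun x => bending_moment P phi x * Derive eta x) x
              /\ continuous (fun x => shear_force P w phi x * eta x) x
              /\ continuous (fun x => - Derive (bending_moment P phi) x * eta x) x).
    { intros x Hx.
      pose proof (C1_on_interval_continuous a b _ x HM Hx).
      pose proof (C1_on_interval_continuous a b _ x HS Hx).
      pose proof (C1_on_interval_continuous a b _ x He Hx).
      pose proof (C1_on_interval_continuous_Derive a b _ x HM Hx).
      pose proof (C1_on_interval_continuous_Derive a b _ x He Hx).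
      repeat split; continuity_R. }
    assert (E1 : ex_RInt (fun x => bending_moment P phi x * Derive eta x) a b)
      by (apply ex_RInt_continuous_R; [exact Hab | apply C]).
    assert (E2 : ex_RInt (fun x => shear_force P w phi x * eta x) a b)
      by (apply ex_RInt_continuous_R; [exact Hab | apply C]).
    assert (E3 : ex_RInt (fun x => - Derive (bending_moment P phi) x * eta x) a b)
      by (apply ex_RInt_continuous_R; [exact Hab | apply C]).
    rewrite (RInt_ext_R _ (fun x => - Derive (bending_moment P phi) x * eta x
                               - shear_force P w phi x * eta x)) by (intros x; ring).
    rewrite (RInt_minus_R _ _ a b E3 E2), <- RInt_by_parts_test by assumption.
    rewrite <- (RInt_minus_R _ _ a b E1 E2).
    rewrite (RInt_ext_R _ (fun x => bending_moment P phi x * Derive eta x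
                               - shear_force P w phi x * eta x)) in D.
    + revert D; apply is_derive_ext; intros eps.
      apply hamiltonian_ext; intros x; ring.
    + intros x; rewrite Derive_const; unfold bending_moment; ring.
Qed.

(** * Fields of class C^k in space and time *)

(** At positive order [C_class] does not state the joint continuity of [f] itself. It follows from
    differentiability: [f] has a continuous time derivative around the point, by openness of [U],
    and an [x]-derivative at the point. *)
Lemma C_class_S (k : nat) (U : R -> R -> Prop) (f : R -> R -> R) :
  (forall t x : R, U t x -> locally_2d U t x) -> C_class (S k) U f -> C_class k U f.
Proof.
  intros HU; revert f; induction k as [|k IH]; intros f.
  - intros [Hd [Ht Hx]] t x Utx.
    apply differentiable_continuity_pt; exists (d_t f t x), (d_x f t x).
    apply filterdiff_differentiable_pt_lim.
    apply (is_derive_filterdiff f t x (d_t f) (d_x f t x)).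
    + apply (locally_2d_locally (fun s y => is_derive (fun z => f z y) s (d_t f s y))).
      apply locally_2d_impl with (2 := HU t x Utx).
      apply locally_2d_forall; intros s y Usy.
      exact (Derive_correct (fun z => f z y) s (proj1 (Hd s y Usy))).
    + exact (Derive_correct (f t) x (proj2 (Hd t x Utx))).
    + exact (proj1 (continuity_2d_pt_filterlim (d_t f) t x) (Ht t x Utx)).
  - intros [Hd [Ht Hx]]; split; [exact Hd|]; split; apply IH; assumption.
Qed.

Lemma C_class_mono (k : nat) (U V : R -> R -> Prop) (f : R -> R -> R) :
  (forall t x : R, V t x -> U t x) -> C_class k U f -> C_class k V f.
Proof.
  intros HVU; revert f; induction k as [|k IH]; intros f.
  - intros H t x Vtx; apply H, HVU, Vtx.
  - intros [Hd [Ht Hx]]; split; [|now split; apply IH].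
    intros t x Vtx; apply Hd, HVU, Vtx.
Qed.

Lemma C_class_continuous (k : nat) (U : R -> R -> Prop) (f : R -> R -> R) (t x : R) :
  (forall t x : R, U t x -> locally_2d U t x) -> C_class k U f -> U t x ->
  continuous (fun z : R * R => f (fst z) (snd z)) (t, x).
Proof.
  intros HU; induction k as [|k IH]; intros Hf Utx.
  - apply continuity_2d_pt_filterlim, Hf, Utx.
  - apply IH; [now apply C_class_S | exact Utx].
Qed.

Lemma continuous_slice (f : R -> R -> R) (t x : R) :
  continuous (fun z : R * R => f (fst z) (snd z)) (t, x) -> continuous (f t) x.
Proof.
  intros Hf.
  apply (continuous_comp_2 (fun _ => t) (fun y => y) f x);
    [apply continuous_const | apply continuous_id | exact Hf].
Qed.

Lemma C_class_1_C1_on_interval (a b : R) (U : R -> R -> Prop) (f : R -> R -> R) (t : R) :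
  (forall t x : R, U t x -> locally_2d U t x) -> C_class 1 U f ->
  (forall x : R, a <= x <= b -> U t x) -> C1_on_interval a b (f t).
Proof.
  intros HU [Hd [_ Hx]] Ut x Hxab.
  generalize (locally_2d_1d_const_x U t x (HU t x (Ut x Hxab))).
  apply filter_imp; intros y Uty; split; [now apply Hd|].
  now apply (continuous_slice (d_x f)), (C_class_continuous 0 U).
Qed.

Lemma C_class_2_Schwarz (U : R -> R -> Prop) (f : R -> R -> R) (t x : R) :
  (forall t x : R, U t x -> locally_2d U t x) -> C_class 2 U f -> U t x ->
  d_t (d_x f) t x = d_x (d_t f) t x.
Proof.
  intros HU [Hd [[Htd [Htt Htx]] [Hxd [Hxt Hxx]]]] Utx.
  apply (Schwarz f).
  - apply locally_2d_impl with (2 := HU t x Utx).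
    apply locally_2d_forall; intros s y Usy.
    exact (conj (proj1 (Hd s y Usy)) (conj (proj2 (Hd s y Usy))
      (conj (proj1 (Hxd s y Usy)) (proj2 (Htd s y Usy))))).
  - exact (Hxt t x Utx).
  - exact (Htx t x Utx).
Qed.

(** * Power balance *)

Definition energy_density (P : params) (w pw phi pphi : R -> R -> R) (t x : R) : R :=
  / (rho P x * area P x) * pw t x ^ 2
  + / (rho P x * inertia P x) * pphi t x ^ 2
  + T0 P x * d_x w t x ^ 2
  + EI P x * d_x phi t x ^ 2
  + AkG P x * (d_x w t x - phi t x) ^ 2.

Definition energy_rate (P : params) (w pw phi pphi : R -> R -> R) (t x : R) : R :=
  2 * (/ (rho P x * area P x) * pw t x * d_t pw t x
       + / (rho P x * inertia P x) * pphi t x * d_t pphi t x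
       + T0 P x * d_x w t x * d_t (d_x w) t x
       + EI P x * d_x phi t x * d_t (d_x phi) t x
       + AkG P x * (d_x w t x - phi t x) * (d_t (d_x w) t x - d_t phi t x)).

Definition energy_flux (P : params) (w phi : R -> R -> R) (t x : R) : R :=
  d_t w t x * transverse_force P (w t) (phi t) x
  + d_t phi t x * bending_moment P (phi t) x.

Definition open_2d (U : R -> R -> Prop) : Prop :=
  forall t x : R, U t x -> locally_2d U t x.

Definition regular_fields (U : R -> R -> Prop) (w pw phi pphi : R -> R -> R) : Prop :=
  C_class 2 U w /\ C_class 1 U pw /\ C_class 2 U phi /\ C_class 1 U pphi.

Lemma regular_fields_static (a b : R) (U : R -> R -> Prop)
    (w pw phi pphi : R -> R -> R) (t : R) :
  open_2d U -> regular_fields U w pw phi pphi ->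
  (forall x : R, a <= x <= b -> U t x) ->
  static_regular a b (w t) (pw t) (phi t) (pphi t).
Proof.
  intros HU (Hw & Hpw & Hphi & Hpphi) Ut; repeat split.
  - now apply (C_class_1_C1_on_interval a b U); [|apply C_class_S|].
  - apply (C_class_1_C1_on_interval a b U (d_x w)); [exact HU | apply Hw | exact Ut].
  - now apply (C_class_1_C1_on_interval a b U); [|apply C_class_S|].
  - apply (C_class_1_C1_on_interval a b U (d_x phi)); [exact HU | apply Hphi | exact Ut].
  - intros x Hx; apply C1_on_interval_continuous with a b; [|exact Hx].
    now apply (C_class_1_C1_on_interval a b U).
  - intros x Hx; apply C1_on_interval_continuous with a b; [|exact Hx].
    now apply (C_class_1_C1_on_interval a b U).
Qed.

Lemma is_derive_energy_density (P : params) (U : R -> R -> Prop)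
    (w pw phi pphi : R -> R -> R) (t x : R) :
  regular_fields U w pw phi pphi -> U t x ->
  is_derive (fun s => energy_density P w pw phi pphi s x) t
    (energy_rate P w pw phi pphi t x).
Proof.
  intros (Hw & Hpw & Hphi & Hpphi) Utx.
  destruct (proj1 Hpw t x Utx) as [Dpw _]; destruct (proj1 Hpphi t x Utx) as [Dpphi _].
  destruct (proj1 Hphi t x Utx) as [Dphi _].
  destruct (proj1 (proj2 (proj2 Hw)) t x Utx) as [Dwx _].
  destruct (proj1 (proj2 (proj2 Hphi)) t x Utx) as [Dphix _].
  unfold energy_density, energy_rate.
  auto_derive; [auto 10|].
  unfold d_t; ring.
Qed.

Lemma continuous_comp_snd (c : R -> R) (t x : R) :
  continuous c x -> continuous (fun z : R * R => c (snd z)) (t, x).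
Proof. intros Hc; apply continuous_comp; [apply continuous_snd | exact Hc]. Qed.

(** Differentiation under the integral sign asks for the rate to be continuous jointly in time and
    space; the slices at fixed time give integrability. *)
Lemma energy_continuous (a b : R) (P : params) (U : R -> R -> Prop)
    (w pw phi pphi : R -> R -> R) (t x : R) :
  admissible a b P -> open_2d U -> regular_fields U w pw phi pphi ->
  U t x -> a <= x <= b ->
  continuous (fun z : R * R => energy_density P w pw phi pphi (fst z) (snd z)) (t, x)
  /\ continuous (fun z : R * R => energy_rate P w pw phi pphi (fst z) (snd z)) (t, x).
Proof.
  intros HP HU (Hw & Hpw & Hphi & Hpphi) Utx Hx.
  destruct (admissible_C1_on_interval a b P HP) as (HT & HE & HA).
  destruct (admissible_continuous_inv a b P x HP Hx) as [Cr Ci].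
  apply (continuous_comp_snd _ t) in Cr, Ci.
  pose proof (continuous_comp_snd _ t x (C1_on_interval_continuous a b _ x HT Hx)).
  pose proof (continuous_comp_snd _ t x (C1_on_interval_continuous a b _ x HE Hx)).
  pose proof (continuous_comp_snd _ t x (C1_on_interval_continuous a b _ x HA Hx)).
  pose proof (C_class_continuous 1 U pw t x HU Hpw Utx).
  pose proof (C_class_continuous 1 U pphi t x HU Hpphi Utx).
  pose proof (C_class_continuous 2 U phi t x HU Hphi Utx).
  pose proof (C_class_continuous 0 U (d_t pw) t x HU (proj1 (proj2 Hpw)) Utx).
  pose proof (C_class_continuous 0 U (d_t pphi) t x HU (proj1 (proj2 Hpphi)) Utx).
  destruct Hw as [_ [_ Hwx]]; destruct Hphi as [_ [Hphit Hphix]].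
  pose proof (C_class_continuous 1 U (d_x w) t x HU Hwx Utx).
  pose proof (C_class_continuous 1 U (d_x phi) t x HU Hphix Utx).
  pose proof (C_class_continuous 1 U (d_t phi) t x HU Hphit Utx).
  pose proof (C_class_continuous 0 U (d_t (d_x w)) t x HU (proj1 (proj2 Hwx)) Utx).
  pose proof (C_class_continuous 0 U (d_t (d_x phi)) t x HU (proj1 (proj2 Hphix)) Utx).
  unfold energy_density, energy_rate; split; continuity_R.
Qed.

Lemma is_derive_hamiltonian_time (a b : R) (P : params) (U : R -> R -> Prop)
    (w pw phi pphi : R -> R -> R) (t : R) :
  a <= b -> admissible a b P -> open_2d U -> regular_fields U w pw phi pphi ->
  locally t (fun s => forall x : R, a <= x <= b -> U s x) ->
  is_derive (fun s => hamiltonian a b P (w s) (pw s) (phi s) (pphi s)) t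
    (/ 2 * RInt (energy_rate P w pw phi pphi t) a b).
Proof.
  intros Hab HP HU Hf Ut; pose proof (locally_singleton _ _ Ut) as Ut0.
  assert (D : forall s x, U s x ->
            Derive (fun s => energy_density P w pw phi pphi s x) s
            = energy_rate P w pw phi pphi s x).
  { intros s x Usx; now apply is_derive_unique, is_derive_energy_density with U. }
  replace (RInt (energy_rate P w pw phi pphi t) a b)
    with (RInt (fun x => Derive (fun s => energy_density P w pw phi pphi s x) t) a b).
  - apply (is_derive_scal (fun s => RInt (energy_density P w pw phi pphi s) a b)).
    apply is_derive_RInt_param; rewrite ?Rmin_left, ?Rmax_right by exact Hab.
    + revert Ut; apply filter_imp; intros s Us x Hx.
      eexists; now apply is_derive_energy_density with U; [|apply Us].
    + intros x Hx.
      (* The condition bears on [Derive] of the density, which equals the explicit rate only on [U];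
         openness of [U] supplies the neighbourhood. *)
      apply continuity_2d_pt_ext_loc with (energy_rate P w pw phi pphi).
      * apply locally_2d_impl with (2 := HU t x (Ut0 x Hx)).
        apply locally_2d_forall; intros s y Usy; symmetry; now apply D.
      * apply continuity_2d_pt_filterlim.
        now apply (energy_continuous a b P U); [..|apply Ut0|].
    + revert Ut; apply filter_imp; intros s Us.
      apply ex_RInt_continuous_R; [exact Hab|]; intros x Hx.
      apply continuous_slice.
      now apply (energy_continuous a b P U); [..|apply Us|].
  - apply RInt_ext; intros x; rewrite Rmin_left, Rmax_right by exact Hab; intros Hx.
    apply D, Ut0; lra.
Qed.

(** Uniqueness of weak variational derivatives replaces the existential witnesses of the system by
    the explicit formulas, at the endpoints included. *)
Lemma timoshenko_system_strong (a b : R) (P : params) (w pw phi pphi : R -> R -> R)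
    (t : R) :
  a < b -> admissible a b P ->
  static_regular a b (w t) (pw t) (phi t) (pphi t) ->
  timoshenko_system a b P w pw phi pphi t ->
  forall x : R, a <= x <= b ->
    d_t w t x = / (rho P x * area P x) * pw t x
    /\ d_t pw t x = Derive (transverse_force P (w t) (phi t)) x
    /\ d_t phi t x = / (rho P x * inertia P x) * pphi t x
    /\ d_t pphi t x = Derive (bending_moment P (phi t)) x
                      + shear_force P (w t) (phi t) x.
Proof.
  intros Hab HP Hs (dw & dpw & dphi & dpphi & Ww & Wpw & Wphi & Wpphi & Heq) x Hx.
  destruct (Heq x Hx) as (-> & -> & -> & ->).
  assert (Hab' := Rlt_le _ _ Hab).
  rewrite (weak_variational_derivative_unique _ _ _ _ _ _ Hab Ww
             (weak_variational_derivative_w _ _ _ _ _ _ _ Hab' HP Hs) x Hx).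
  rewrite (weak_variational_derivative_unique _ _ _ _ _ _ Hab Wpw
             (weak_variational_derivative_pw _ _ _ _ _ _ _ Hab' HP Hs) x Hx).
  rewrite (weak_variational_derivative_unique _ _ _ _ _ _ Hab Wphi
             (weak_variational_derivative_phi _ _ _ _ _ _ _ Hab' HP Hs) x Hx).
  rewrite (weak_variational_derivative_unique _ _ _ _ _ _ Hab Wpphi
             (weak_variational_derivative_pphi _ _ _ _ _ _ _ Hab' HP Hs) x Hx).
  repeat split; ring.
Qed.

(** Each momentum term of the rate is a velocity times the divergence of a force, and each strain
    term a force times the [x]-derivative of a velocity: together they form product rules. The shear
    work [d_t phi * shear_force] appears once from the equation for [pphi] and once, with the
    opposite sign, from the shear energy, and cancels. *)
Lemma is_derive_energy_flux (a b : R) (P : params) (U : R -> R -> Prop)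
    (w pw phi pphi : R -> R -> R) (t x : R) :
  a < b -> admissible a b P -> open_2d U -> regular_fields U w pw phi pphi ->
  (forall x : R, a <= x <= b -> U t x) ->
  timoshenko_system a b P w pw phi pphi t ->
  a <= x <= b ->
  is_derive (fun y => 2 * energy_flux P w phi t y) x (energy_rate P w pw phi pphi t x).
Proof.
  intros Hab HP HU Hf Ut Hsys Hx.
  pose proof (regular_fields_static a b U w pw phi pphi t HU Hf Ut) as Hs.
  destruct (timoshenko_system_strong _ _ _ _ _ _ _ _ Hab HP Hs Hsys x Hx)
    as (Ew & Epw & Ephi & Epphi).
  destruct Hs as (_ & Hdw & Hphi & Hdphi & _ & _).
  pose proof (C1_on_interval_ex_derive _ _ _ x
                (transverse_force_C1_on_interval a b P (w t) (phi t) HP Hdw Hphi) Hx) as DF.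
  pose proof (C1_on_interval_ex_derive _ _ _ x
                (bending_moment_C1_on_interval a b P (phi t) HP Hdphi) Hx) as DM.
  destruct Hf as (Cw & _ & Cphi & _).
  destruct (proj1 (proj1 (proj2 Cw)) t x (Ut x Hx)) as [_ Dw].
  destruct (proj1 (proj1 (proj2 Cphi)) t x (Ut x Hx)) as [_ Dphi].
  unfold energy_flux; auto_derive; [auto|].
  change (fun x => d_t w t x) with (d_t w t).
  change (fun x => d_t phi t x) with (d_t phi t).
  change (fun x => transverse_force P (w t) (phi t) x)
    with (transverse_force P (w t) (phi t)).
  change (fun x => bending_moment P (phi t) x) with (bending_moment P (phi t)).
  change (Derive (d_t w t) x) with (d_x (d_t w) t x).
  change (Derive (d_t phi t) x) with (d_x (d_t phi) t x).
  rewrite <- (C_class_2_Schwarz U w), <- (C_class_2_Schwarz U phi) by auto.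
  unfold energy_rate; rewrite Epw, Epphi, <- Ew, <- Ephi.
  (* Only the undifferentiated occurrences are unfolded; under [Derive] the forces remain atoms for
     [ring]. *)
  unfold transverse_force at 1, bending_moment at 1, shear_force, d_x; ring.
Qed.

Theorem theorem12 (a b : R) (Hab : a < b) (t0 t1 : Rbar) (P : params)
  (HP : admissible a b P)
  (w pw phi pphi : R -> R -> R)
  (Hw : C_class_near 2 (space_time t0 t1 a b) w)
  (Hpw : C_class_near 1 (space_time t0 t1 a b) pw)
  (Hphi : C_class_near 2 (space_time t0 t1 a b) phi)
  (Hpphi : C_class_near 1 (space_time t0 t1 a b) pphi)
  (Hsol : forall t : R, in_time t0 t1 t ->
            timoshenko_system a b P w pw phi pphi t) :
  forall t : R, in_time t0 t1 t ->
    is_derive (fun s : R => hamiltonian a b P (w s) (pw s) (phi s) (pphi s)) t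
      (boundary_bracket
         (fun x => d_t w t x
                     * (T0 P x * d_x w t x + AkG P x * (d_x w t x - phi t x))
                   + d_t phi t x * (EI P x * d_x phi t x)) a b).
Proof.
  intros t Ht.
  destruct Hw as (U1 & O1 & D1 & Cw), Hpw as (U2 & O2 & D2 & Cpw),
    Hphi as (U3 & O3 & D3 & Cphi), Hpphi as (U4 & O4 & D4 & Cpphi).
  (* Each field comes with its own open neighbourhood of the space-time domain; their intersection
     serves all four. *)
  set (U := fun s x => (U1 s x /\ U2 s x) /\ (U3 s x /\ U4 s x)).
  assert (HU : open_2d U).
  { intros s x [[? ?] [? ?]]; repeat apply locally_2d_and; auto. }
  assert (Hf : regular_fields U w pw phi pphi).
  { refine (conj (C_class_mono 2 U1 U w _ Cw) (conj (C_class_mono 1 U2 U pw _ Cpw)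
      (conj (C_class_mono 2 U3 U phi _ Cphi) (C_class_mono 1 U4 U pphi _ Cpphi))));
      intros s x [[? ?] [? ?]]; assumption. }
  assert (Ut : locally t (fun s => forall x : R, a <= x <= b -> U s x)).
  { apply (locally_interval _ t t0 t1); [apply Ht | apply Ht |].
    intros s H0 H1 x Hx; assert (Hsx : space_time t0 t1 a b s x) by easy.
    repeat split; auto. }
  pose proof (locally_singleton _ _ Ut) as Ut0.
  pose proof (is_derive_hamiltonian_time a b P U w pw phi pphi t
                (Rlt_le _ _ Hab) HP HU Hf Ut) as D.
  rewrite (RInt_derivative a b (fun x => 2 * energy_flux P w phi t x)) in D.
  - replace (/ 2 * _) with (energy_flux P w phi t b - energy_flux P w phi t a) in D
      by field.
    (* The bracket of the statement is this difference of fluxes up to unfolding. *)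
    exact D.
  - now apply Rlt_le.
  - intros x Hx; apply is_derive_energy_flux with a b U; auto.
  - intros x Hx; apply continuous_slice.
    now apply (energy_continuous a b P U); [..|apply Ut0|].
Qed.
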